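(* Let $\mathcal{C}$ be the class of all finite groups that are both minimal non-Iwasawa groups and modular groups. Then $\mathcal{C}$ consists exactly of all Schmidt groups $G=PQ$ with $P$ cyclic of order $p$, where $P$ is the normal Sylow $p$-subgroup of $G$ and $Q$ is a cyclic Sylow $q$-subgroup of $G$ ($p\neq q$ primes). That is, a finite group $G$ belongs to $\mathcal{C}$ if and only if $G$ is a Schmidt group whose normal Sylow $p$-subgroup $P$ has order $p$.
   Context: All groups are finite. $L(G)$ denotes the lattice of all subgroups of a group $G$. A subgroup $H$ of $G$ is permutable if $HK=KH$ for all $K\in L(G)$. $G$ is an Iwasawa group if all its subgroups are permutable. $G$ is a modular group if the lattice $L(G)$ is modular. For a class of groups $\mathcal{X}$, a group $G$ is a minimal non-$\mathcal{X}$ group if $G\notin\mathcal{X}$ but all proper subgroups of $G$ belong to $\mathcal{X}$. A Schmidt group is a minimal non-nilpotent group, i.e. a finite non-nilpotent group all of whose proper subgroups are nilpotent. By a classical theorem of Schmidt, such a group has order $p^mq^n$ for distinct primes $p,q$ (with $m,n\geq 1$), has a unique (hence normal) Sylow $p$-subgroup $P$ and a cyclic (non-normal) Sylow $q$-subgroup $Q$, so that $G=PQ$ is a semidirect product of $P$ by $Q$; the notation $G=PQ$ for a Schmidt group always refers to this decomposition. *)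

(* Defs.v *)
(* A finite group is a G : {group gT}, with gT : finGroupType;
   its subgroup lattice L(G) is [subgroups G], with meet :&: and join <*>. *)
From HB Require Import structures.
From mathcomp Require Import all_boot all_order all_fingroup all_solvable.
Set Implicit Arguments.
Unset Strict Implicit.
Unset Printing Implicit Defensive.

Local Open Scope group_scope.

Section Classes.

Variable gT : finGroupType.
Implicit Types (G H K P Q : {group gT}) (p q : nat).

Definition permutable G H : bool :=
  (H \in subgroups G) && [forall K in subgroups G, H * K == K * H].

Definition iwasawa G : bool := [forall H in subgroups G, permutable G H].

(* Modular law in L(G): X v (Y ^ Z) = (X v Y) ^ Z whenever X <= Z. *)
Definition modular G : bool :=
  [forall X in subgroups G, forall Y in subgroups G, forall Z in subgroups G,
    (X \subset Z) ==> (X <*> (Y :&: Z) == (X <*> Y) :&: Z)].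

Definition minimal_non (X : pred {group gT}) G : bool :=
  ~~ X G && [forall H : {group gT}, (H \proper G) ==> X H].

Definition schmidt_group G : bool := minimal_non (fun H => nilpotent H) G.

(* The decomposition G = PQ of Schmidt's theorem.  Nontriviality of P and Q is
   implied: if either were trivial, Q would be normal in G. *)
Definition schmidt_decomposition p q G P Q : Prop :=
  [/\ [/\ prime p, prime q & p != q],
      p.-Sylow(G) P /\ P <| G,
      [/\ q.-Sylow(G) Q, cyclic Q & ~~ (Q <| G)]
    & P ><| Q = G].

Definition modular_minimal_non_iwasawa G : bool :=
  minimal_non iwasawa G && modular G.

End Classes.

(* Main.v *)
(* Iwasawa groups are nilpotent, and a nilpotent modular group with Iwasawa
   proper subgroups is Iwasawa, so a group G in the class is a Schmidt group.
   If Q is a non-normal Sylow q-subgroup of a modular Schmidt group G, then Q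
   and any conjugate Q^x <> Q generate G; the modular law then forces Q to be
   maximal in G and D = Q :&: Q^x to be maximal in Q and normal in G. Hence Q
   minus D is a TI-subset with normaliser Q, and its conjugates cover at
   least half of G. Two primes cannot both do this, so some other Sylow
   subgroup P is normal, and the modular law applied to S <= P and Q shows
   that P has no subgroup 1 < S < P, whence #|P| = p. Conversely, if #|P| = p
   then all proper subgroups of G are cyclic and every subgroup is normal or
   maximal in G, so L(G) is modular. *)
Require Import Defs.
From mathcomp Require Import all_boot all_order all_fingroup all_solvable.
Local Open Scope group_scope.

Section Groups.

Set Implicit Arguments.
Unset Strict Implicit.

Variable gT : finGroupType.
Implicit Types (G H K M N P Q R X Y Z : {group gT}) (p q r : nat).

(** * Reflection of the boolean definitions *)

Lemma iwasawaP G :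
  reflect (forall H K, H \subset G -> K \subset G -> commute H K) (iwasawa G).
Proof.
apply: (iffP forall_inP) => [iwaG H K sHG sKG | permG H sHG].
  have /iwaG/andP[_ /forall_inP-permH] : H \in subgroups G by rewrite inE.
  by apply/eqP/permH; rewrite inE.
rewrite /permutable sHG; apply/forall_inP=> K sKG.
by apply/eqP/permG; [rewrite inE in sHG | rewrite inE in sKG].
Qed.

Lemma modularP G :
  reflect (forall X Y Z, X \subset G -> Y \subset G -> Z \subset G ->
             X \subset Z -> X <*> (Y :&: Z) = (X <*> Y) :&: Z)
          (modular G).
Proof.
apply: (iffP forall_inP) => [modG X Y Z sXG sYG sZG sXZ | modG X].
  have /modG/forall_inP-modX : X \in subgroups G by rewrite inE.
  have /modX/forall_inP-modXY : Y \in subgroups G by rewrite inE.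
  have /modXY/implyP/(_ sXZ)/eqP-> // : Z \in subgroups G by rewrite inE.
rewrite inE => sXG; apply/forall_inP=> Y; rewrite inE => sYG.
apply/forall_inP=> Z; rewrite inE => sZG.
by apply/implyP=> sXZ; apply/eqP/modG.
Qed.

Lemma minimal_nonP (C : pred {group gT}) G :
  reflect (~~ C G /\ forall H, H \proper G -> C H) (minimal_non C G).
Proof.
apply: (iffP andP) => [[nCG /forallP minC] | [nCG minC]]; split=> //.
  by move=> H /(implyP (minC H)).
by apply/forallP=> H; apply/implyP/minC.
Qed.

(** * Nilpotency and permutability *)

Lemma Sylow_normal_nilpotent G :
  (forall q Q, prime q -> q.-Sylow(G) Q -> Q <| G) -> nilpotent G.
Proof.
move=> nsG; have sGF : G \subset 'F(G).
  rewrite -{1}(Sylow_gen G) gen_subG; apply/bigcupsP=> Q /SylowP[q q_pr sylQ].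
  apply: Fitting_max (nsG q Q q_pr sylQ) _.
  exact: pgroup_nil (pHall_pgroup sylQ).
exact: nilpotentS sGF (Fitting_nil G).
Qed.

(** The product [Q * Q :^ x] is then a q-subgroup of [G] containing [Q], so it equals [Q]. *)
Lemma permutable_Sylow_normal q G Q :
    q.-Sylow(G) Q -> (forall x, x \in G -> commute Q (Q :^ x)) -> Q <| G.
Proof.
move=> sylQ permQ; have [sQG qQ _] := and3P sylQ.
rewrite /normal sQG; apply/subsetP=> x Gx; rewrite inE.
have sQxG : Q :^ x \subset G by rewrite conj_subG.
have defQQx : Q <*> (Q :^ x)%G = Q * (Q :^ x)%G.
  exact: comm_joingE (permQ x Gx).
have qQQx : q.-group (Q <*> (Q :^ x)%G).
  by rewrite defQQx pgroupM qQ pgroupJ.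
have defQ : Q <*> (Q :^ x)%G = Q.
  apply: (sub_pHall sylQ qQQx); first exact: joing_subl.
  by rewrite join_subG sQG.
by have := joing_subr Q (Q :^ x)%G; rewrite defQ.
Qed.

Lemma iwasawa_nilpotent G : iwasawa G -> nilpotent G.
Proof.
move/iwasawaP=> permG; apply: Sylow_normal_nilpotent => q Q _ sylQ.
have sQG := pHall_sub sylQ.
apply: (permutable_Sylow_normal sylQ) => x Gx.
by apply: (permG Q (Q :^ x)%G); rewrite ?conj_subG.
Qed.

Lemma abelian_iwasawa G : abelian G -> iwasawa G.
Proof.
move=> cGG; apply/iwasawaP=> H K sHG sKG.
exact: centC (centSS sHG sKG cGG).
Qed.

Lemma nilpotent_maximal_normal G M : nilpotent G -> maximal M G -> M <| G.
Proof.
move=> nilG maxM; have [ltMG maxMG] := maxgroupP maxM.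
rewrite /normal proper_sub //=; apply/setIidPl/eqP.
rewrite eqEproper subsetIl /=; apply/negP=> ltNG.
have := nilpotent_proper_norm nilG ltMG.
by rewrite (maxMG 'N_G(M)%G) ?properxx // subsetI normG proper_sub.
Qed.

(** Only pairs [H], [K] generating [G] need work: any other pair already commutes inside the proper
    Iwasawa subgroup [H <*> K]. *)
Lemma nilpotent_modular_iwasawa G :
    nilpotent G -> modular G -> (forall H, H \proper G -> iwasawa H) ->
  iwasawa G.
Proof.
move=> nilG /modularP-modG iwaS; apply/iwasawaP=> H K sHG sKG.
have sHKG : H <*> K \subset G by rewrite join_subG sHG.
have [defG | ltHKG] := eqVproper sHKG; last first.
  have /iwasawaP-permHK := iwaS (H <*> K)%G ltHKG.
  by apply: permHK; rewrite ?joing_subl ?joing_subr.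
have [-> | [M maxM sHM]] := maximal_exists sHG.
  by rewrite /commute mulGSid ?mulSGid.
have nsMG := nilpotent_maximal_normal nilG maxM.
have ltMG := maxgroupp maxM; have sMG := proper_sub ltMG.
have not_sKM : ~~ (K \subset M).
  apply: contraL ltMG => sKM.
  by rewrite properE sMG negbK -defG join_subG sHM.
(* The modular law gives M = H (K :&: M), so that H K = M K = G. *)
have defM : H * (K :&: M) = M.
  have permHKM : commute H (K :&: M)%G.
    have /iwasawaP-permM := iwaS M ltMG.
    by apply: permM; rewrite ?subsetIr.
  by rewrite -(comm_joingE permHKM) modG // defG; apply/setIidPr.
have defHK : H * K = G.
  rewrite -[RHS](mulg_normal_maximal nsMG maxM sKG not_sKM) -{1}defM -mulgA.
  by rewrite (mulSGid (subsetIl K M)).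
by apply: (elimT comm_group_setP); rewrite defHK groupP.
Qed.

(** * Non-normal Sylow subgroups of modular Schmidt groups *)

Lemma nilpotent_Sylow_norm q G H Q :
    q.-Sylow(G) Q -> Q \subset H -> H \subset G -> nilpotent H -> Q <| H.
Proof.
move=> sylQ sQH sHG nilH.
by rewrite (nilpotent_Hall_pcore nilH (pHall_subl sQH sHG sylQ)) pcore_normal.
Qed.

(** Were the join proper, it would be nilpotent and so have only one Sylow q-subgroup. *)
Lemma schmidt_join_conj G q Q x :
    schmidt_group G -> q.-Sylow(G) Q -> x \in G -> Q :^ x != Q ->
  Q <*> Q :^ x = G.
Proof.
move=> /minimal_nonP[_ nilS] sylQ Gx neqQx; have sQG := pHall_sub sylQ.
have sylQx : q.-Sylow(G) (Q :^ x)%G by rewrite pHallJ.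
have sJG : Q <*> (Q :^ x)%G \subset G.
  by rewrite join_subG sQG (pHall_sub sylQx).
have [// | ltJG] := eqVproper sJG; case/eqP: neqQx.
have nilJ := nilS (Q <*> (Q :^ x)%G)%G ltJG.
have defQ := nilpotent_Hall_pcore nilJ (pHall_subl (joing_subl _ _) sJG sylQ).
have defQx := nilpotent_Hall_pcore nilJ (pHall_subl (joing_subr _ _) sJG sylQx).
exact: etrans defQx (esym defQ).
Qed.

Lemma nonnormal_Sylow_conj q G Q :
    q.-Sylow(G) Q -> ~~ (Q <| G) -> exists2 x, x \in G & Q :^ x != Q.
Proof.
move=> /pHall_sub-sQG; rewrite /normal sQG => /subsetPn[x Gx nQx].
by exists x => //; apply: contra nQx => /eqP-eqQx; rewrite inE eqQx.
Qed.

Lemma nonnormal_Sylow_maximal G q Q :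
    schmidt_group G -> modular G -> q.-Sylow(G) Q -> ~~ (Q <| G) ->
  maximal Q G.
Proof.
move=> schG /modularP-modG sylQ nnsQG; have sQG := pHall_sub sylQ.
have [/minimal_nonP[_ nilS] qQ] := (schG, pHall_pgroup sylQ).
have [x Gx neqQx] := nonnormal_Sylow_conj sylQ nnsQG.
have sQxG : Q :^ x \subset G by rewrite conj_subG.
have [defQ | [M maxM sQM]] := maximal_exists sQG.
  by rewrite defQ normal_refl in nnsQG.
have ltMG := maxgroupp maxM; have sMG := proper_sub ltMG.
have nsQM := nilpotent_Sylow_norm sylQ sQM sMG (nilS M ltMG).
(* [Q] is the normal Sylow q-subgroup of the nilpotent [M], so it absorbs every q-subgroup of [M];
   the modular law then collapses [M] to [Q]. *)
have sQxMQ : Q :^ x :&: M \subset Q.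
  rewrite (sub_normal_Hall (pHall_subl sQM sMG sylQ)) ?subsetIr //.
  by rewrite (pgroupS (subsetIl _ _)) //= pgroupJ.
have defM : Q <*> (Q :^ x :&: M) = M.
  rewrite (modG Q (Q :^ x)%G M) //=.
  by rewrite (schmidt_join_conj schG sylQ Gx neqQx); apply/setIidPr.
suff -> : Q = M by [].
by apply: val_inj; rewrite /= -defM; apply/esym/joing_idPl.
Qed.

Lemma nonnormal_Sylow_core G q Q :
    schmidt_group G -> modular G -> prime q -> q.-Sylow(G) Q -> ~~ (Q <| G) ->
  exists2 D : {group gT}, D <| G & maximal D Q.
Proof.
move=> schG modG q_pr sylQ nnsQG; have [sQG qQ _] := and3P sylQ.
have [x Gx neqQx] := nonnormal_Sylow_conj sylQ nnsQG.
have sQxG : Q :^ x \subset G by rewrite conj_subG.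
have defG := schmidt_join_conj schG sylQ Gx neqQx.
have sylQx : q.-Sylow(G) (Q :^ x)%G by rewrite pHallJ.
have maxQx : maximal (Q :^ x)%G G.
  apply: nonnormal_Sylow_maximal sylQx _ => //.
  by rewrite -(conjGid Gx) normalJ.
pose D := (Q :&: Q :^ x)%G.
have ltDQ : D \proper Q.
  rewrite properE subsetIl subsetI subxx /=.
  by apply: contra neqQx => sQQx; rewrite eq_sym eqEcard sQQx cardJg leqnn.
have maxD : maximal D Q.
  apply/maxgroupP; split=> // E ltEQ sDE; have sEQ := proper_sub ltEQ.
  have sEG := subset_trans sEQ sQG.
  (* By the modular law, [E] is recovered from [E <*> Q :^ x], which lies between the maximal
     subgroup [Q :^ x] and [G]; hence only two values of [E] are possible. *)
  have defE : E = (E <*> Q :^ x) :&: Q :> {set gT}.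
    rewrite -(modularP _ modG E (Q :^ x)%G Q) //=.
    by apply/esym/joing_idPl; rewrite setIC.
  have /maximal_eqP[_ maxQxG] : maximal_eq (Q :^ x)%G G
    by rewrite /maximal_eq maxQx orbT.
  have [||defJ|defJ] := maxQxG (E <*> Q :^ x)%G.
  - exact: joing_subr.
  - by rewrite join_subG sEG.
    by rewrite defE; move: defJ => /= ->; rewrite setIC.
  case/eqP: (proper_neq ltEQ); rewrite defE; move: defJ => /= ->.
  exact/setIidPr.
exists D => //; rewrite /normal subIset ?sQG //= -defG join_subG.
rewrite (normal_norm (p_maximal_normal qQ maxD)) /=.
have sDQx : D \subset (Q :^ x)%G := subsetIr _ _.
(* [D] has the same index q in [Q :^ x] as in [Q]; being normal in both, it is normal in their join
   [G]. *)
have maxDx : maximal D (Q :^ x)%G.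
  apply: p_index_maximal => //.
  rewrite -divgS // cardJg divgS; last exact: subsetIl.
  by rewrite (p_maximal_index qQ maxD).
exact: normal_norm (p_maximal_normal (pHall_pgroup sylQx) maxDx).
Qed.

Lemma nonnormal_Sylow_support G q Q :
    schmidt_group G -> modular G -> prime q -> q.-Sylow(G) Q -> ~~ (Q <| G) ->
  exists S : {set gT},
    [/\ S \subset G^#, {in S, forall x, q.-elt x} & #|G| <= #|S|.*2].
Proof.
move=> schG modG q_pr sylQ nnsQG; have [sQG qQ _] := and3P sylQ.
have [D nsDG maxD] := nonnormal_Sylow_core schG modG q_pr sylQ nnsQG.
have maxQ := nonnormal_Sylow_maximal schG modG sylQ nnsQG.
have [ltDQ maxDQ] := maxgroupP maxD; have sDQ := proper_sub ltDQ.
have defNQ : 'N_G(Q) = Q.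
  have [_ maxQG] := maxgroupP maxQ; apply: (maxQG 'N_G(Q)%G).
    by move: nnsQG; rewrite properE subsetIl subsetI subxx /normal sQG.
  by rewrite subsetI sQG normG.
have tiD : normedTI (Q :\: D) G Q.
  apply/normedTI_P; split.
  - by rewrite setD_eq0 proper_subn.
  - rewrite subsetI sQG normsD ?normG //.
    by rewrite (subset_trans sQG (normal_norm nsDG)).
  (* For [g] outside the self-normalising [Q], the intersection [Q :&: Q :^ g] is proper in [Q] and
     contains the normal [D], so it equals [D] by maximality. *)
  move=> g Gg; apply: contraR => notQg.
  have sDQg : D \subset Q :^ g
    by rewrite -(normsP (normal_norm nsDG) g Gg) conjSg.
  have ltQQg : Q :&: Q :^ g \proper Q.
    rewrite properE subsetIl subsetI subxx /=; apply: contra notQg => sQQg.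
    have eqQg : Q = Q :^ g :> {set gT}
      by apply/eqP; rewrite eqEcard sQQg cardJg leqnn.
    by rewrite -defNQ 2!inE Gg -eqQg subxx.
  have defD : Q :&: Q :^ g = D
    by apply: (maxDQ (Q :&: Q :^ g)%G); rewrite // subsetI sDQ.
  rewrite -setI_eq0 conjDg setIDA -subset0; apply/subsetP=> y.
  rewrite !inE => /andP[_ /andP[/andP[notDy Qy] Qgy]].
  by rewrite -defD inE Qy Qgy in notDy.
exists (class_support (Q :\: D) G); split.
- rewrite subsetD1 class_support_subG ?(subset_trans (subsetDl _ _)) //=.
  apply/imset2P=> [[x g /setDP[_ notDx] Gg] /esym/eqP].
  by rewrite conjg_eq1 => /eqP-x1; rewrite x1 group1 in notDx.
- move=> _ /imset2P[x g /setDP[Qx _] Gg ->].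
  by rewrite p_eltJ (mem_p_elt qQ).
(* The support has [(#|Q| - #|D|) * #|G : Q|] elements and [#|Q| = #|D| * q], so the bound reduces
   to [2 <= q]. *)
rewrite (card_support_normedTI tiD) cardsD (setIidPr sDQ) -(Lagrange sQG).
rewrite -muln2 mulnAC leq_mul // muln2 -(Lagrange sDQ).
rewrite (p_maximal_index qQ maxD).
rewrite doubleB -(addnn (#|D| * q)) -addnBA ?leq_addr //.
by rewrite -muln2 leq_mul2l prime_gt1 ?orbT.
Qed.

(** For distinct primes the two supports are disjoint, and two sets of at least half the size of [G]
    do not fit disjointly into [G^#]. *)
Lemma nonnormal_Sylow_uniq G q r Q R :
    schmidt_group G -> modular G -> prime q -> prime r ->
    q.-Sylow(G) Q -> r.-Sylow(G) R -> ~~ (Q <| G) -> ~~ (R <| G) ->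
  q = r.
Proof.
move=> schG modG q_pr r_pr sylQ sylR nnsQ nnsR; apply/eqP.
have [S [sSG qS leGS]] := nonnormal_Sylow_support schG modG q_pr sylQ nnsQ.
have [T [sTG rT leGT]] := nonnormal_Sylow_support schG modG r_pr sylR nnsR.
apply: contraLR (leq_add leGS leGT) => neq_qr.
have tiST : S :&: T = set0.
  apply/setP=> x; rewrite !inE; apply/andP=> [[Sx Tx]].
  have /setD1P[/eqP[]] := subsetP sSG x Sx.
  apply/eqP; rewrite -order_eq1; apply/eqP; apply: pnat_1 (qS x Sx) _.
  by apply: sub_p_elt (rT x Tx) => i; rewrite !inE => /eqP->; rewrite eq_sym.
rewrite -ltnNge -doubleD addnn ltn_double.
rewrite -cardsUI tiST cards0 addn0 (cardsD1 1 G) group1 ltnS.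
by rewrite subset_leq_card // subUset sSG.
Qed.

(** * From the class to a normal Sylow subgroup of prime order *)

Lemma modular_minimal_non_iwasawa_schmidt G :
  modular_minimal_non_iwasawa G -> schmidt_group G.
Proof.
case/andP=> /minimal_nonP[niwG iwaS] modG; apply/minimal_nonP; split.
  by apply: contra niwG => nilG; apply: nilpotent_modular_iwasawa.
by move=> H ltHG; apply/iwasawa_nilpotent/iwaS.
Qed.

Lemma schmidt_modular_normal_Sylow G :
    schmidt_group G -> modular G ->
  exists p P, [/\ prime p, p.-Sylow(G) P, P <| G & #|P| = p].
Proof.
move=> schG modG; have /minimal_nonP[nnilG _] := schG.
have [/exists_inP[Q /SylowP[q q_pr sylQ] nnsQ] | allN] :=
  boolP [exists (Q : {group gT} | Sylow G Q), ~~ (Q <| G)]; last first.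
  case/negP: nnilG; apply: Sylow_normal_nilpotent => q Q q_pr sylQ.
  apply: contraR allN => nnsQ; apply/exists_inP; exists Q => //.
  by apply/SylowP; exists q.
have [sQG qQ q'GQ] := and3P sylQ.
have maxQ := nonnormal_Sylow_maximal schG modG sylQ nnsQ.
have /maximal_eqP[_ maxQG] : maximal_eq Q G by rewrite /maximal_eq maxQ orbT.
have iGQ_gt1 : 1 < #|G : Q| by rewrite indexg_gt1 proper_subn ?(maxgroupp maxQ).
(* As [#|G : Q|] is a q'-number, [r] differs from [q], and so its Sylow subgroup must be normal. *)
pose r := pdiv #|G : Q|; have r_pr : prime r := pdiv_prime iGQ_gt1.
have neq_rq : r != q
  by apply: (pnatP _ (indexg_gt0 G Q) q'GQ); rewrite ?pdiv_dvd.
have [P sylP] := Sylow_exists r G; have [sPG rP _] := and3P sylP.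
have nsPG : P <| G.
  apply: contraR neq_rq => nnsP.
  by rewrite (nonnormal_Sylow_uniq schG modG r_pr q_pr sylP sylQ nnsP nnsQ).
have tiPQ : P :&: Q = 1.
  apply/coprime_TIg/(pnat_coprime rP).
  by apply: sub_in_pnat qQ => i _ /eqP->; rewrite !inE eq_sym.
have r_dv_P : r %| #|P|.
  rewrite (card_Hall sylP) p_part dvdn_exp // logn_gt0 mem_primes r_pr.
  rewrite cardG_gt0.
  exact: dvdn_trans (pdiv_dvd _) (dvdn_indexg _ _).
have [x Px ox] := Cauchy r_pr r_dv_P.
have sxP : <[x]> \subset P by rewrite cycle_subG.
have sxG := subset_trans sxP sPG.
have defG : <[x]> <*> Q = G.
  have [||defJ|//] := maxQG (<[x]> <*> Q)%G.
  - exact: joing_subr.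
  - by rewrite join_subG sxG.
  have Qx : x \in Q by rewrite -cycle_subG -defJ joing_subl.
  have /set1gP-x1 : x \in [1 gT] by rewrite -tiPQ inE Px.
  by move: r_pr; rewrite -ox x1 order1.
(* Modular law with [<[x]>] below [P]: [P = (<[x]> <*> Q) :&: P = <[x]> <*> (Q :&: P) = <[x]>]. *)
exists r, P; split=> //; rewrite -ox /order; congr #|pred_of_set _|.
rewrite -(setIidPr sPG) -{1}defG.
rewrite -(modularP _ modG <[x]>%G Q P) //=.
by rewrite setIC tiPQ joingG1.
Qed.

(** * Decomposition of a Schmidt group with a given normal Sylow subgroup *)

Lemma schmidt_coprime_cent G H K :
    schmidt_group G -> H <*> K \proper G -> coprime #|H| #|K| ->
  K \subset 'C(H).
Proof.
move=> /minimal_nonP[_ nilS] ltJG coHK.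
apply: (sub_nilpotent_cent2 (nilS (H <*> K)%G ltJG)) => //.
  exact: joing_subl.
exact: joing_subr.
Qed.

(** A complement [K] of [P] does not centralise [P], since [G] is not nilpotent, but all its proper
    subgroups do. An element of prime power order in [K] acting nontrivially on [P] therefore
    generates [K]. *)
Lemma schmidt_normal_Sylow_decomposition G p P :
    schmidt_group G -> prime p -> p.-Sylow(G) P -> P <| G -> P :!=: 1 ->
  exists q Q, schmidt_decomposition p q G P Q.
Proof.
move=> schG p_pr sylP nsPG ntP; have /minimal_nonP[nnilG nilS] := schG.
have [sPG pP _] := and3P sylP.
have /splitsP[K /complP[tiPK defG]] :=
  SchurZassenhaus_split (pHall_Hall sylP) nsPG.
have sKG : K \subset G by rewrite -defG mulG_subr.
have nPK := subset_trans sKG (normal_norm nsPG).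
have cardG : (#|P| * #|K|)%N = #|G| by rewrite -TI_cardMg ?defG.
have P_gt1 : 1 < #|P| by rewrite cardG_gt1.
have p'K : p^'.-group K.
  by have [_ _] := and3P sylP; rewrite -divgS // -cardG mulKn.
have coPK : coprime #|P| #|K| by apply: pnat_coprime pP p'K.
have ltKG : K \proper G by rewrite properEcard sKG -cardG ltn_Pmull.
have nilK := nilS K ltKG.
have centP H : H \proper K -> H \subset 'C(P).
  move=> ltHK; have sHK := proper_sub ltHK.
  apply: (schmidt_coprime_cent schG) (coprimegS sHK coPK).
  rewrite properEcard join_subG sPG (subset_trans sHK) //=.
  rewrite norm_joinEr ?(subset_trans sHK) // -cardG.
  by rewrite coprime_cardMg ?(coprimegS sHK) // ltn_pmul2l ?proper_card.
have not_cPK : ~~ (K \subset 'C(P)).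
  apply: contra nnilG => cPK.
  by rewrite (dprod_nil (etrans (dprodE cPK tiPK) defG)) (pgroup_nil pP).
have [x Kx not_cPx] := subsetPn not_cPK.
(* [x] is the product of its primary constituents, so they cannot all centralise [P]. *)
have [q not_cPy] : exists q : nat, x.`_q \notin 'C(P).
  have [/existsP[q] | /existsPn-cPx] :=
    boolP [exists q : 'I_#[x].+1, x.`_q \notin 'C(P)].
    by exists q.
  case/negP: not_cPx; rewrite -(prod_constt x) big_mkord.
  by apply: group_prod => q _; rewrite -[_ \in _]negbK cPx.
pose y := x.`_q; have qy : q.-elt y := p_elt_constt q x.
have defK : K = <[y]>%G.
  have syK : <[y]> \subset K by rewrite cycle_subG groupX.
  have [eqyK | ltyK] := eqVproper syK; first exact/val_inj/esym.
  by case/negP: not_cPy; rewrite -cycle_subG centP.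
have qK : q.-group K by rewrite defK.
have ntK : K :!=: 1 by apply: contraNneq not_cPK => ->; rewrite sub1G.
have [q_pr q_dv_K _] := pgroup_pdiv qK ntK.
have neq_pq : p != q by rewrite eq_sym; apply: (pgroupP p'K).
have sylK : q.-Sylow(G) K.
  rewrite /pHall sKG qK -divgS // -cardG mulnK //=.
  by apply: sub_in_pnat pP => i _ /eqP->.
exists q, K; split=> //; last by rewrite sdprodE.
split=> //; first by rewrite defK cycle_cyclic.
(* If [K] were normal, the Fitting subgroup would contain both [P] and [K], hence [G]. *)
apply: contra nnilG => nsKG; apply: nilpotentS (Fitting_nil G).
by rewrite -{1}defG mul_subG ?Fitting_max // (pgroup_nil pP).
Qed.

(** * Modularity when the normal Sylow subgroup has prime order *)

(** Serves to make proper subgroups cyclic: they are nilpotent with cyclic Sylow subgroups. *)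
Lemma Zgroup_schmidt_decomposition p q G P Q :
    schmidt_decomposition p q G P Q -> #|P| = p -> Zgroup G.
Proof.
case=> [[p_pr _ _] [sylP _] [sylQ cycQ _] defG] oP.
have cycP : cyclic P by rewrite prime_cyclic ?oP.
apply/forall_inP=> V /SylowP[r r_pr sylV].
have [eq_rp | neq_rp] := eqVneq r p.
  rewrite eq_rp in sylV; have [x _ ->] := Sylow_trans sylP sylV.
  by rewrite cyclicJ.
have [eq_rq | neq_rq] := eqVneq r q.
  rewrite eq_rq in sylV; have [x _ ->] := Sylow_trans sylQ sylV.
  by rewrite cyclicJ.
suff -> : V :=: 1 by exact: cyclic1.
rewrite -(setIidPl (pHall_sub sylV)); apply/coprime_TIg.
apply: (pnat_coprime (pHall_pgroup sylV)); rewrite -(sdprod_card defG) pnatM.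
apply/andP; split.
  by apply: sub_in_pnat (pHall_pgroup sylP) => i _ /eqP->; rewrite !inE eq_sym.
by apply: sub_in_pnat (pHall_pgroup sylQ) => i _ /eqP->; rewrite !inE eq_sym.
Qed.

Lemma schmidt_proper_cyclic p q G P Q H :
    schmidt_group G -> schmidt_decomposition p q G P Q -> #|P| = p ->
  H \proper G -> cyclic H.
Proof.
move=> /minimal_nonP[_ nilS] decG oP ltHG.
apply: nil_Zgroup_cyclic (nilS H ltHG).
exact: ZgroupS (proper_sub ltHG) (Zgroup_schmidt_decomposition decG oP).
Qed.

(** The cases depend on a Sylow q-subgroup [M] of [H]. If [M] is Sylow in [G], the index of [H]
    divides p. Otherwise [P <*> M] is proper, [M] centralises [P], and [H] is a product of two
    normal subgroups of [G], namely ['O_p(H)] and [M]. *)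
Lemma schmidt_subgroup_normal_or_maximal p q G P R H :
    schmidt_group G -> schmidt_decomposition p q G P R -> #|P| = p ->
  H \subset G -> H <| G \/ maximal H G.
Proof.
move=> schG decG oP sHG; have /minimal_nonP[_ nilS] := schG.
have [defH | ltHG] := eqVproper sHG; first by left; rewrite defH normal_refl.
have [[p_pr q_pr neq_pq] [sylP nsPG] [sylR _ _] defG0] := decG.
have [sPG pP _] := and3P sylP.
have [M sylM] := Sylow_exists q H; have [sMH qM _] := and3P sylM.
have [Q sylQ sMQ] := Sylow_superset (subset_trans sMH sHG) qM.
have [sQG qQ _] := and3P sylQ.
have coPq K : q.-group K -> coprime #|P| #|K|.
  move=> qK; apply: (pnat_coprime pP); apply: sub_in_pnat qK => i _ /eqP->.
  by rewrite !inE eq_sym.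
have cardG : (#|P| * #|Q|)%N = #|G|.
  by rewrite -(sdprod_card defG0) (card_Hall sylQ) (card_Hall sylR).
have nPQ := subset_trans sQG (normal_norm nsPG).
have defG : P * Q = G.
  by apply/eqP; rewrite eqEcard mul_subG //= coprime_cardMg ?cardG ?coPq.
have [defM | ltMQ] := eqVproper sMQ.
  right; apply: p_index_maximal => //.
  have sQH : Q \subset H by rewrite -defM.
  have iHG : #|G : H| %| p.
    by rewrite -oP -(@mulnK #|P| #|Q|) // cardG divgS // indexgS.
  by rewrite (prime_nt_dvdP p_pr _ iHG) // indexg_eq1 proper_subn.
left; have cPM : M \subset 'C(P).
  apply: (schmidt_coprime_cent schG) (coPq M qM).
  rewrite properEcard join_subG sPG (subset_trans sMQ) //=.
  rewrite norm_joinEr ?(subset_trans sMQ) // -cardG.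
  by rewrite coprime_cardMg ?coPq // ltn_pmul2l ?proper_card.
have ltQG : Q \proper G.
  by rewrite properEcard sQG -cardG ltn_Pmull // oP prime_gt1.
have cycQ := schmidt_proper_cyclic schG decG oP ltQG.
have nsMG : M <| G.
  rewrite /normal (subset_trans sMQ) //= -defG mul_subG //.
    by rewrite cents_norm // centsC.
  exact: sub_abelian_norm (cyclic_abelian cycQ) sMQ.
have sOP : 'O_p(H) \subset P.
  rewrite (sub_normal_Hall sylP) ?pcore_pgroup //.
  exact: subset_trans (pcore_sub _ _) sHG.
have nsOG : 'O_p(H) <| G.
  by apply: char_normal_trans nsPG; rewrite sub_cyclic_char // prime_cyclic ?oP.
(* [#|H : M|] divides [#|P| * #|Q|] and is prime to q, hence divides [#|P|]. *)
have p'M : p^'.-Hall(H) M.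
  rewrite /pHall sMH /= pnatNK; apply/andP; split.
    by apply: sub_pgroup qM => i /eqP->; rewrite !inE eq_sym.
  apply: (@pnat_dvd _ #|P|) => //.
  rewrite -(@Gauss_dvdl _ _ #|Q|).
    by rewrite cardG (dvdn_trans (dvdn_indexg H M)) ?cardSg.
  by rewrite coprime_sym (pnat_coprime qQ) //; case/and3P: sylM.
have defM := nilpotent_Hall_pcore (nilS H ltHG) p'M.
have [_ <- _ _] := dprodP (nilpotent_pcoreC p (nilS H ltHG)).
by rewrite -defM normalM.
Qed.

(** For [X] normal, joins with [X] are products and Dedekind's law applies; for [X] maximal, [Z] can
    only be [X] or [G]. *)
Lemma normal_or_maximal_modular G :
    (forall H, H \subset G -> H <| G \/ maximal H G) -> modular G.
Proof.
move=> nsmG; apply/modularP=> X Y Z sXG sYG sZG sXZ.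
have [nsXG | maxX] := nsmG X sXG.
  have nX K : K \subset G -> K \subset 'N(X).
    by move/subset_trans; apply; exact: normal_norm.
  have sYZG : Y :&: Z \subset G by rewrite subIset ?sYG.
  by rewrite !norm_joinEr ?nX // group_modl.
have /maximal_eqP[_ maxXG] : maximal_eq X G by rewrite /maximal_eq maxX orbT.
have [->|->] := maxXG Z sXZ sZG.
  by rewrite (joing_idPl (subsetIr _ _)) (setIidPr (joing_subl _ _)).
by rewrite (setIidPl sYG) (setIidPl _) // join_subG sXG.
Qed.

End Groups.

Theorem corollary2 (gT : finGroupType) (G : {group gT}) :
  (modular_minimal_non_iwasawa G <->
     schmidt_group G /\
     exists (p q : nat) (P Q : {group gT}),
       schmidt_decomposition p q G P Q /\ #|P| = p)
  /\
  (modular_minimal_non_iwasawa G <->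
     schmidt_group G /\
     exists (p : nat) (P : {group gT}),
       [/\ prime p, p.-Sylow(G) P, P <| G & #|P| = p]).
Proof.
(* Both equivalences follow from a cycle of implications: decomposition, class, normal Sylow
   subgroup of order p, decomposition. *)
have dec_class : schmidt_group G /\
    (exists (p q : nat) (P Q : {group gT}),
       schmidt_decomposition p q G P Q /\ #|P| = p) ->
  modular_minimal_non_iwasawa G.
  case=> schG [p [q [P [Q [decG oP]]]]]; apply/andP; split.
    have /minimal_nonP[nnilG _] := schG; apply/minimal_nonP; split.
      by apply: contra nnilG; apply: iwasawa_nilpotent.
    move=> H ltHG; apply/abelian_iwasawa/cyclic_abelian.
    exact: schmidt_proper_cyclic schG decG oP ltHG.
  apply: normal_or_maximal_modular => H.
  exact: schmidt_subgroup_normal_or_maximal schG decG oP.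
have class_sylow : modular_minimal_non_iwasawa G ->
  schmidt_group G /\
  exists (p : nat) (P : {group gT}),
    [/\ prime p, p.-Sylow(G) P, P <| G & #|P| = p].
  move=> clG; have schG := modular_minimal_non_iwasawa_schmidt clG.
  by split=> //; apply: schmidt_modular_normal_Sylow; case/andP: clG.
have sylow_dec : (schmidt_group G /\
    exists (p : nat) (P : {group gT}),
      [/\ prime p, p.-Sylow(G) P, P <| G & #|P| = p]) ->
  schmidt_group G /\
  (exists (p q : nat) (P Q : {group gT}),
     schmidt_decomposition p q G P Q /\ #|P| = p).
  case=> schG [p [P [p_pr sylP nsPG oP]]]; split=> //.
  have ntP : P :!=: 1 by rewrite -cardG_gt1 oP prime_gt1.
  have [q [Q decG]] :=
    schmidt_normal_Sylow_decomposition schG p_pr sylP nsPG ntP.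
  by exists p, q, P, Q.
by split; split; auto.
Qed.
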